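(* Algorithm-A (described in the context) decides CIS in time $O(\delta_0^n)$, where $n$ is the number of vertices of the input graph system and $\delta_0=1.4423\approx\sqrt[3]{3}$. That is, on every graph system $\mathcal{G}$ it returns true if and only if $\mathcal{G}$ has a good independent set, within the stated time.
   Context: A graph system is a tuple $\mathcal{G}=(G_0,G_1,\ldots,G_m)$ with $m\ge 1$, where all $G_i$ are graphs over the same finite vertex set $V$, $G_0$ is an undirected graph without self-loops, and $G_1,\ldots,G_m$ are directed graphs that may contain self-loops. Let $E_i$ be the edge set of $G_i$. For $\Gamma\subseteq V$ and $1\le i\le m$, a vertex $u\in\Gamma$ is $G_i$-good in $\Gamma$ if there is $v\in\Gamma$ (possibly $v=u$) with $(u,v)\in E_i$; it is good in $\Gamma$ if it is $G_i$-good in $\Gamma$ for every $1\le i\le m$, and bad in $\Gamma$ otherwise. A good independent set (GIS) is a non-empty set $\Gamma\subseteq V$ that is independent in $G_0$ and all of whose vertices are good in $\Gamma$. CIS is the problem: given $\mathcal{G}$, decide whether it has a GIS. Procedure 1, on input $\mathcal{G}$ and a set $Y\subseteq V$ independent in $G_0$: set $\Gamma:=Y$; while there is a bad vertex $u$ in $\Gamma$, set $\Gamma:=\Gamma\setminus\{u\}$; return true if $\Gamma\ne\emptyset$ and false otherwise. Algorithm-A, on input $\mathcal{G}$: enumerate all maximal (with respect to inclusion) independent sets $Y$ of $G_0$, using an algorithm that lists all of them in time $O(3^{n/3}\cdot\mathrm{poly}(n))$ (such algorithms are known); for each $Y$ run Procedure 1 on $(\mathcal{G},Y)$ and return true if it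 returns true; if no $Y$ succeeds, return false. Running times are measured in $n=|V|$; factors polynomial in the number $m$ of directed graphs are suppressed. *)

(* Defs.v *)
From mathcomp Require Import all_boot all_order all_algebra.
From mathcomp Require Import reals exp.
Import Order.TTheory GRing.Theory Num.Theory.

Set Implicit Arguments.
Unset Strict Implicit.
Unset Printing Implicit Defensive.

(* The directed graphs G_1, ..., G_m are indexed by 'I_m: index i : 'I_m stands
   for G_(i+1). *)
Record graph_system (V : finType) := GraphSystem {
  num_digraphs : nat;
  edge0 : rel V;
  edge : 'I_num_digraphs -> rel V;
  num_digraphs_gt0 : 0 < num_digraphs;
  edge0_sym : symmetric edge0;
  edge0_irr : irreflexive edge0
}.

Section GoodIndependentSets.

Variables (V : finType) (G : graph_system V).
Implicit Types (S : {set V}) (u : V).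

Definition independent S : bool :=
  [forall u in S, forall v in S, ~~ edge0 G u v].

Definition maximal_independent S : bool := maxset independent S.

Definition good_at (i : 'I_(num_digraphs G)) S u : bool :=
  [exists v in S, edge i u v].

Definition good S u : bool := [forall i, good_at i S u].

Definition is_gis S : bool :=
  [&& S != set0, independent S & [forall u in S, good S u]].

Definition has_gis : Prop := exists S, is_gis S.

End GoodIndependentSets.

(* Running time is measured on a random-access machine: finitely many named
   registers, one memory with indirect addressing, and a read-only input.
   Registers and cells hold natural numbers; the arithmetic is limited to
   addition and truncated subtraction, so that the unit-cost measure is
   harmless. *)
Inductive expr : Type :=
| Cst of nat
| Reg of nat
| Mem of expr                    (* content of the addressed memory cell *)
| NumVertices
| NumDigraphs
| Adj of expr & expr & expr      (* Adj i u v: is (u, v) an edge of G_i? *)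
| Add of expr & expr
| Sub of expr & expr
| Lt of expr & expr
| And of expr & expr.

Inductive cmd : Type :=
| Skip
| Assign of nat & expr           (* register := value *)
| Store of expr & expr           (* memory cell := value *)
| Seq of cmd & cmd
| If of expr & cmd & cmd
| While of expr & cmd.

Record input := Input {
  in_vertices : nat;
  in_digraphs : nat;
  in_adj : nat -> nat -> nat -> bool
}.

Record state := State { regs : nat -> nat; memory : nat -> nat }.

Definition init_state : state := State (fun _ => 0) (fun _ => 0).

Definition upd (f : nat -> nat) (a x : nat) : nat -> nat :=
  fun b => if b == a then x else f b.

(* Truth values are numbers, any nonzero number being true. *)
Fixpoint eval (I : input) (s : state) (e : expr) : nat :=
  match e with
  | Cst c => c
  | Reg x => regs s x
  | Mem e1 => memory s (eval I s e1)
  | NumVertices => in_vertices I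
  | NumDigraphs => in_digraphs I
  | Adj e1 e2 e3 => in_adj I (eval I s e1) (eval I s e2) (eval I s e3)
  | Add e1 e2 => eval I s e1 + eval I s e2
  | Sub e1 e2 => eval I s e1 - eval I s e2
  | Lt e1 e2 => eval I s e1 < eval I s e2
  | And e1 e2 => (eval I s e1 != 0) && (eval I s e2 != 0)
  end.

Fixpoint expr_cost (e : expr) : nat :=
  match e with
  | Cst _ | Reg _ | NumVertices | NumDigraphs => 1
  | Mem e1 => (expr_cost e1).+1
  | Adj e1 e2 e3 => (expr_cost e1 + expr_cost e2 + expr_cost e3).+1
  | Add e1 e2 | Sub e1 e2 | Lt e1 e2 | And e1 e2 =>
      (expr_cost e1 + expr_cost e2).+1
  end.

(* exec I c s s' t: on input I, started in state s, the command c halts in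
   state s' after t elementary steps. *)
Inductive exec (I : input) : cmd -> state -> state -> nat -> Prop :=
| ExecSkip s : exec I Skip s s 1
| ExecAssign s x e :
    exec I (Assign x e) s (State (upd (regs s) x (eval I s e)) (memory s))
      (expr_cost e).+1
| ExecStore s a e :
    exec I (Store a e) s
      (State (regs s) (upd (memory s) (eval I s a) (eval I s e)))
      (expr_cost a + expr_cost e).+1
| ExecSeq c1 c2 s s1 s2 t1 t2 :
    exec I c1 s s1 t1 -> exec I c2 s1 s2 t2 ->
    exec I (Seq c1 c2) s s2 (t1 + t2)
| ExecIfTrue e c1 c2 s s' t :
    eval I s e != 0 -> exec I c1 s s' t ->
    exec I (If e c1 c2) s s' ((expr_cost e).+1 + t)
| ExecIfFalse e c1 c2 s s' t :
    eval I s e = 0 -> exec I c2 s s' t ->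
    exec I (If e c1 c2) s s' ((expr_cost e).+1 + t)
| ExecWhileFalse e c s :
    eval I s e = 0 -> exec I (While e c) s s (expr_cost e).+1
| ExecWhileTrue e c s s1 s2 t1 t2 :
    eval I s e != 0 -> exec I c s s1 t1 -> exec I (While e c) s1 s2 t2 ->
    exec I (While e c) s s2 ((expr_cost e).+1 + t1 + t2).

(* Adjacency queries on a graph system: the vertices are numbered from 0 to
   #|V|-1 by enum_rank, layer 0 is the undirected graph G_0, and layer i with
   1 <= i <= m is the directed graph G_i. Queries out of range return false. *)
Definition system_adj (V : finType) (G : graph_system V) (i u v : nat) : bool :=
  match (insub u : option 'I_#|V|), (insub v : option 'I_#|V|) with
  | Some ku, Some kv =>
      let x := enum_val ku in
      let y := enum_val kv in
      match i with
      | 0 => edge0 G x y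
      | j.+1 =>
          match (insub j : option 'I_(num_digraphs G)) with
          | Some k => edge k x y
          | None => false
          end
      end
  | _, _ => false
  end.

Definition system_input (V : finType) (G : graph_system V) : input :=
  Input #|V| (num_digraphs G) (system_adj G).

(* Register conventions. The enumeration subroutine leaves the number of listed
   sets in r_count and the sets, as consecutive characteristic vectors of length
   n, in memory from address 0. Algorithm-A leaves its answer in r_ans. *)
Definition r_count := 0.
Definition r_ans := 1.
Definition r_k := 2.
Definition r_base := 3.
Definition r_found := 4.
Definition r_u := 5.
Definition r_i := 6.
Definition r_good := 7.
Definition r_v := 8.

Definition listed_set (V : finType) (s : state) (k : nat) : {set V} :=
  [set x : V | memory s (k * #|V| + enum_rank x) != 0].

Definition listed_sets (V : finType) (s : state) : seq {set V} :=
  [seq listed_set V s k | k <- iota 0 (regs s r_count)].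

Definition lists_maximal_independent_sets (V : finType) (G : graph_system V)
    (s : state) : Prop :=
  perm_eq (listed_sets V s) (enum (maximal_independent G)).

Declare Scope ram_scope.
Delimit Scope ram_scope with ram.
Notation "c1 ;; c2" := (Seq c1 c2)
  (at level 90, right associativity, format "c1  ;; '/' c2") : ram_scope.
Notation "x ::= e" := (Assign x e) (at level 85, no associativity) : ram_scope.
Local Open Scope ram_scope.

Definition Not (e : expr) : expr := Lt e (Cst 1).
Definition incr (x : nat) : cmd := x ::= Add (Reg x) (Cst 1).

(* The cell telling whether the vertex in register x belongs to Gamma. *)
Definition cell (x : nat) : expr := Add (Reg r_base) (Reg x).

(* r_good := is the vertex r_u G_i-good in Gamma, for i = r_i? *)
Definition check_good : cmd :=
  r_good ::= Cst 0 ;;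
  r_v ::= Cst 0 ;;
  While (Lt (Reg r_v) NumVertices)
    (If (And (Mem (cell r_v)) (Adj (Reg r_i) (Reg r_u) (Reg r_v)))
       (r_good ::= Cst 1)
       Skip ;;
     incr r_v).

(* Look for a bad vertex of Gamma; remove the first one found, if any, and
   record in r_found whether there was one. *)
Definition remove_bad : cmd :=
  r_found ::= Cst 0 ;;
  r_u ::= Cst 0 ;;
  While (And (Lt (Reg r_u) NumVertices) (Not (Reg r_found)))
    (If (Mem (cell r_u))
       (r_i ::= Cst 1 ;;
        While (Lt (Reg r_i) (Add NumDigraphs (Cst 1)))
          (check_good ;;
           If (Reg r_good) Skip (r_found ::= Cst 1) ;;
           incr r_i) ;;
        If (Reg r_found) (Store (cell r_u) (Cst 0)) Skip)
       Skip ;;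
     incr r_u).

(* r_ans := is Gamma nonempty? *)
Definition test_nonempty : cmd :=
  r_ans ::= Cst 0 ;;
  r_u ::= Cst 0 ;;
  While (Lt (Reg r_u) NumVertices)
    (If (Mem (cell r_u)) (r_ans ::= Cst 1) Skip ;;
     incr r_u).

(* The set Y is the characteristic vector at address r_base; Gamma is obtained
   by updating that vector in place. *)
Definition procedure1 : cmd :=
  r_found ::= Cst 1 ;;
  While (Reg r_found) remove_bad ;;
  test_nonempty.

Definition algorithmA (enumerate : cmd) : cmd :=
  enumerate ;;
  r_ans ::= Cst 0 ;;
  r_k ::= Cst 0 ;;
  r_base ::= Cst 0 ;;
  While (And (Lt (Reg r_k) (Reg r_count)) (Not (Reg r_ans)))
    (procedure1 ;;
     incr r_k ;;
     r_base ::= Add (Reg r_base) NumVertices).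

Local Close Scope ram_scope.
Local Open Scope ring_scope.

Definition delta0 (R : realType) : R := 14423 / 10000.

(* The enumeration subroutine lists every maximal independent set of G_0 exactly
   once, within C * (n+1)^d * 3^(n/3) steps for some constants C and d. *)
Definition mis_enumerator (R : realType) (enumerate : cmd) : Prop :=
  exists (C : R) (d : nat),
    forall (V : finType) (G : graph_system V), exists (s : state) (t : nat),
      [/\ exec (system_input G) enumerate init_state s t,
          lists_maximal_independent_sets G s
        & t%:R <= C * (#|V|.+1)%:R ^+ d * 3 `^ (#|V|%:R / 3)].

(* "c decides CIS in time O(delta^n)", with constants C and d independent of the
   graph system; the factor m^d is the suppressed polynomial in m. *)
Definition decides_cis_in_time (R : realType) (c : cmd) (delta : R) : Prop :=
  exists (C : R) (d : nat),
    forall (V : finType) (G : graph_system V), exists (s : state) (t : nat),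
      [/\ exec (system_input G) c init_state s t,
          regs s r_ans != 0%N <-> has_gis G
        & t%:R <= C * (num_digraphs G)%:R ^+ d * delta ^+ #|V|].

(* Main.v *)
Require Import Defs.
From mathcomp Require Import all_boot all_order all_algebra.
From mathcomp Require Import reals exp.
From mathcomp Require Import zify ring lra.
Import Order.TTheory GRing.Theory Num.Theory.

Set Implicit Arguments.
Unset Strict Implicit.
Unset Printing Implicit Defensive.

(** Procedure 1 keeps every subset of Y all of whose vertices are good in it, and
    stops at a set of good vertices; hence it succeeds on Y exactly when Y
    contains a GIS, and every GIS lies in some maximal independent set. One run
    takes O(m n^3) steps. The number of runs is bounded without the Moon-Moser
    theorem: the memory is initially zero and the listed sets are non-empty and
    stored in disjoint blocks, so listing N sets takes at least N steps. The total
    is a polynomial times 3^(n/3), which is absorbed because 3 < 1.4423^3. *)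

(** * What a command can change, and how fast *)

Fixpoint assigned (c : cmd) : seq nat :=
  match c with
  | Skip | Store _ _ => [::]
  | Assign x _ => [:: x]
  | Seq c1 c2 | If _ c1 c2 => assigned c1 ++ assigned c2
  | While _ c1 => assigned c1
  end.

Fixpoint stores (c : cmd) : bool :=
  match c with
  | Skip | Assign _ _ => false
  | Store _ _ => true
  | Seq c1 c2 | If _ c1 c2 => stores c1 || stores c2
  | While _ c1 => stores c1
  end.

(** A purely syntactic over-approximation of the effect of a command. The rules for [runs] supply it
    for free, so that loop invariants need not mention registers that the loop leaves alone. *)
Definition frame (c : cmd) (s s' : state) : Prop :=
  (forall x, x \notin assigned c -> regs s' x = regs s x) /\
  (~~ stores c -> memory s' = memory s).

Lemma frame_refl c s : frame c s s.
Proof. by []. Qed.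

Lemma frame_trans c s1 s2 s3 : frame c s1 s2 -> frame c s2 s3 -> frame c s1 s3.
Proof.
move=> [r12 m12] [r23 m23]; split=> [x xc|nc]; first by rewrite r23 // r12.
by rewrite m23 // m12.
Qed.

Lemma exec_frame I c s s' t : exec I c s s' t -> frame c s s'.
Proof.
elim=> {c s s' t} //=.
- by move=> s x e; split=> //= y; rewrite inE /upd => /negPf ->.
- move=> c1 c2 s s1 s2 t1 t2 _ [r1 m1] _ [r2 m2]; split=> /= [x|].
    by rewrite mem_cat negb_or => /andP[? ?]; rewrite r2 // r1.
  by rewrite negb_or => /andP[? ?]; rewrite m2 // m1.
- move=> e c1 c2 s s1 t _ _ [r1 m1]; split=> /= [x|].
    by rewrite mem_cat negb_or => /andP[? ?]; rewrite r1.
  by rewrite negb_or => /andP[? ?]; rewrite m1.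
- move=> e c1 c2 s s1 t _ _ [r1 m1]; split=> /= [x|].
    by rewrite mem_cat negb_or => /andP[? ?]; rewrite r1.
  by rewrite negb_or => /andP[? ?]; rewrite m1.
- by move=> e c s s1 s2 t1 t2 _ _ f1 _ f2; apply: frame_trans f1 f2.
Qed.

Lemma exec_time_gt0 I c s s' t : exec I c s s' t -> 0 < t.
Proof. by elim=> {c s s' t} //= *; lia. Qed.

(** A [Store] changes one cell and costs at least one step, so the addresses written form a list no
    longer than the run. This feeds the lower bound on the time needed to list many sets. *)
Lemma exec_memory_changes I c s s' t : exec I c s s' t ->
  exists2 l : seq nat, size l <= t &
    forall a, memory s' a != memory s a -> a \in l.
Proof.
elim=> {c s s' t} /=.
- by move=> s; exists [::] => // a; rewrite eqxx.
- by move=> s x e; exists [::] => // a; rewrite eqxx.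
- move=> s a e; exists [:: eval I s a] => [//|b]; rewrite /upd inE.
  by case: (b =P _) => // _; rewrite eqxx.
- move=> c1 c2 s s1 s2 t1 t2 _ [l1 z1 h1] _ [l2 z2 h2]; exists (l1 ++ l2).
    by rewrite size_cat leq_add.
  move=> a ne; rewrite mem_cat; have [/h1 -> //|/negbNE/eqP e1] :=
    boolP (memory s1 a != memory s a).
  by rewrite h2 ?orbT // e1.
- by move=> e c1 c2 s s' t _ _ [l z h]; exists l => //; lia.
- by move=> e c1 c2 s s' t _ _ [l z h]; exists l => //; lia.
- by move=> e c s _; exists [::] => // a; rewrite eqxx.
- move=> e c s s1 s2 t1 t2 _ _ [l1 z1 h1] _ [l2 z2 h2]; exists (l1 ++ l2).
    by rewrite size_cat; lia.
  move=> a ne; rewrite mem_cat; have [/h1 -> //|/negbNE/eqP e1] :=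
    boolP (memory s1 a != memory s a).
  by rewrite h2 ?orbT // e1.
Qed.

(** * A program logic for total correctness with step bounds *)

Definition runs (I : input) (c : cmd) (s : state) (T : nat)
    (Q : state -> Prop) : Prop :=
  exists s' t, [/\ exec I c s s' t, t <= T & Q s'].

Lemma runs_weaken I c s T T' (Q Q' : state -> Prop) :
  runs I c s T Q -> T <= T' ->
  (forall s', frame c s s' -> Q s' -> Q' s') -> runs I c s T' Q'.
Proof.
move=> [s' [t [ex tT q]]] TT' QQ'; exists s', t; split=> //.
  exact: leq_trans tT TT'.
exact: QQ' (exec_frame ex) q.
Qed.

Lemma runs_skip I s T (Q : state -> Prop) : 0 < T -> Q s -> runs I Skip s T Q.
Proof. by move=> T0 q; exists s, 1; split=> //; apply: ExecSkip. Qed.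

Lemma runs_assign I s x e (Q : state -> Prop) :
  Q (State (upd (regs s) x (eval I s e)) (memory s)) ->
  runs I (Assign x e) s (expr_cost e).+1 Q.
Proof. by move=> q; eexists; eexists; split; [apply: ExecAssign| |]. Qed.

Lemma runs_store I s a e (Q : state -> Prop) :
  Q (State (regs s) (upd (memory s) (eval I s a) (eval I s e))) ->
  runs I (Store a e) s (expr_cost a + expr_cost e).+1 Q.
Proof. by move=> q; eexists; eexists; split; [apply: ExecStore| |]. Qed.

(** The run of [c2] is itself the postcondition of [c1], in weakest-precondition style: no
    intermediate assertion has to be named, and a program is traversed from left to right. *)
Lemma runs_seq I c1 c2 s T1 T2 (Q : state -> Prop) :
  runs I c1 s T1 (fun s1 => frame c1 s s1 -> runs I c2 s1 T2 Q) ->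
  runs I (Seq c1 c2) s (T1 + T2) Q.
Proof.
move=> [s1 [t1 [ex1 tT1 h]]]; have [s2 [t2 [ex2 tT2 q]]] := h (exec_frame ex1).
by exists s2, (t1 + t2); split=> //; [apply: ExecSeq ex1 ex2|apply: leq_add].
Qed.

Lemma runs_if I e c1 c2 s T (Q : state -> Prop) :
  (eval I s e != 0 -> runs I c1 s T Q) -> (eval I s e = 0 -> runs I c2 s T Q) ->
  runs I (If e c1 c2) s ((expr_cost e).+1 + T) Q.
Proof.
move=> h1 h2; have [e0|e0] := eqVneq (eval I s e) 0.
  have [s' [t [ex tT q]]] := h2 e0; exists s', ((expr_cost e).+1 + t).
  by split=> //; [apply: ExecIfFalse|rewrite leq_add2l].
have [s' [t [ex tT q]]] := h1 e0; exists s', ((expr_cost e).+1 + t).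
by split=> //; [apply: ExecIfTrue|rewrite leq_add2l].
Qed.

Lemma runs_while I e c s B (mu : state -> nat) (P : state -> Prop) :
  P s ->
  (forall s1, frame c s s1 -> P s1 -> eval I s1 e != 0 ->
     runs I c s1 B (fun s2 => frame c s1 s2 -> P s2 /\ mu s2 < mu s1)) ->
  runs I (While e c) s (mu s * ((expr_cost e).+1 + B) + (expr_cost e).+1)
    (fun s' => P s' /\ eval I s' e = 0).
Proof.
move=> Ps step.
(* Strong induction on the variant, carried out through a strict upper bound [N]. *)
suff H N s1 : P s1 -> frame c s s1 -> mu s1 < N ->
    runs I (While e c) s1 (mu s1 * ((expr_cost e).+1 + B) + (expr_cost e).+1)
      (fun s' => P s' /\ eval I s' e = 0).
  exact: H Ps (frame_refl c s) (leqnn _).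
elim: N s1 => // N IH s1 P1 f1 muN.
have [e0|e0] := eqVneq (eval I s1 e) 0.
  exists s1, (expr_cost e).+1; split=> //; first exact: ExecWhileFalse.
  by rewrite leq_addl.
have [s2 [t1 [ex1 t1B h2]]] := step _ f1 P1 e0.
have f12 := exec_frame ex1; have [P2 mu2] := h2 f12.
have [|s3 [t2 [ex2 t2B h3]]] := IH s2 P2 (frame_trans f1 f12) _; first by lia.
exists s3, ((expr_cost e).+1 + t1 + t2); split=> //.
  exact: ExecWhileTrue ex1 ex2.
(* As [mu s2 < mu s1], one copy of the cost per iteration splits off and pays for this pass. *)
have := leq_mul mu2 (leqnn ((expr_cost e).+1 + B)); rewrite mulSn; lia.
Qed.

(** * The subroutines of Procedure 1 on numbered vertices *)

(** Goodness is first stated for a raw input, with the set read off a memory block, so that the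
    program can be analysed before any graph system enters. *)
Definition good_number (I : input) (mem : nat -> nat) (base i u : nat) : bool :=
  has (fun v => (mem (base + v) != 0) && in_adj I i u v)
    (iota 0 (in_vertices I)).

Definition bad_number (I : input) (mem : nat -> nat) (base u : nat) : bool :=
  ~~ all (fun i => good_number I mem base i u) (iota 1 (in_digraphs I)).

Lemma runs_check_good I s :
  runs I check_good s (30 * (in_vertices I).+1) (fun s' =>
    (regs s' r_good != 0) =
      good_number I (memory s) (regs s r_base) (regs s r_i) (regs s r_u)).
Proof.
set n := in_vertices I.
pose p v := (memory s (regs s r_base + v) != 0) &&
            in_adj I (regs s r_i) (regs s r_u) v.
(* The two assignments cost 2 each. An iteration costs 4 for the guard and at most 19 for the body;
   the final 4 is the failing test. *)
apply: (runs_weaken (T := 2 + (2 + (n * 23 + 4)))); [|lia|by move=> s' _; exact].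
apply: runs_seq; apply: runs_assign => _.
apply: runs_seq; apply: runs_assign => _; set s1 := State _ _ => /=.
have -> : n * 23 + 4 = (n - regs s1 r_v) * (4 + 19) + 4 by rewrite /= subn0.
apply: (runs_weaken (Q := fun s' => ((regs s' r_v <= n) /\
   (regs s' r_good != 0) = has p (iota 0 (regs s' r_v))) /\
    eval I s' (Lt (Reg r_v) NumVertices) = 0) _ (leqnn _)).
  apply: (runs_while (mu := fun s => n - regs s r_v)) => //.
  move=> s2 [fr fm] [le2 g2] lt2.
  have m2 : memory s2 = memory s by rewrite fm.
  have b2 : regs s2 r_base = regs s r_base by rewrite fr.
  have u2 : regs s2 r_u = regs s r_u by rewrite fr.
  have i2 : regs s2 r_i = regs s r_i by rewrite fr.
  have {}lt2 : regs s2 r_v < n by move: lt2 => /=; rewrite -/n; case: ltnP.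
  have hS k : has p (iota 0 k.+1) = has p (iota 0 k) || p k.
    by rewrite -addn1 iotaD has_cat /= orbF.
  have ev : eval I s2 (And (Defs.Mem (cell r_v)) (Adj (Reg r_i) (Reg r_u) (Reg r_v)))
            = p (regs s2 r_v).
    by rewrite /= /p m2 b2 u2 i2; case: in_adj.
  apply: (runs_weaken (T := (9.+1 + 2) + 4)) => [|//|s' f' h]; last exact: h.
  apply: runs_seq; apply: runs_if => [|]; rewrite ev => pv.
    apply: runs_assign => _; apply: runs_assign => _ /=.
    rewrite /upd /= addn1 hS; split; last by lia.
    by split=> //; case: (p _) pv => //; rewrite orbT.
  apply: runs_skip => // _; apply: runs_assign => _ /=.
  rewrite /upd /= addn1 hS g2; split; last by lia.
  by split=> //; case: (p _) pv => //; rewrite orbF.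
move=> s' _ [[le' ->]] /= e0.
suff -> : regs s' r_v = n by [].
by apply/eqP; rewrite eqn_leq le' /= leqNgt; case: ltnP e0.
Qed.

(** This is the inner loop of [remove_bad]. It never resets [r_found], so that register, starting
    from 0, ends nonzero exactly when some layer fails. The index starts at 1 because layer 0 is the
    undirected graph. *)
Lemma runs_check_vertex I s :
  regs s r_i = 1 -> regs s r_found = 0 ->
  runs I (While (Lt (Reg r_i) (Add NumDigraphs (Cst 1)))
            (Seq check_good
               (Seq (If (Reg r_good) Skip (Assign r_found (Cst 1)))
                  (incr r_i)))) s
    (in_digraphs I * (30 * (in_vertices I).+1 + 14) + 6)
    (fun s' => (regs s' r_found != 0) =
       bad_number I (memory s) (regs s r_base) (regs s r_u)).
Proof.
set n := in_vertices I; set m := in_digraphs I => i1 f0.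
pose p i := good_number I (memory s) (regs s r_base) i (regs s r_u).
have -> : m * (30 * n.+1 + 14) + 6 =
    (m.+1 - regs s r_i) * (6 + (30 * n.+1 + ((2 + 2) + 4))) + 6.
  by rewrite i1 subSS subn0; congr (_ * _ + _); lia.
(* The layers tested so far are 1 up to [r_i - 1], hence the predecessor and the positivity of [r_i]
   in the invariant. *)
apply: (runs_weaken (Q := fun s' => (0 < regs s' r_i <= m.+1 /\
   (regs s' r_found != 0) = ~~ all p (iota 1 (regs s' r_i).-1)) /\
    eval I s' (Lt (Reg r_i) (Add NumDigraphs (Cst 1))) = 0) _ (leqnn _)).
  apply: (runs_while (mu := fun s => m.+1 - regs s r_i)).
    by rewrite i1 f0.
  move=> s2 [fr fm] [/andP[i2_gt0 i2_le] found2] lt2.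
  have m2 : memory s2 = memory s by rewrite fm.
  have b2 : regs s2 r_base = regs s r_base by rewrite fr.
  have u2 : regs s2 r_u = regs s r_u by rewrite fr.
  have {}lt2 : regs s2 r_i < m.+1.
    by move: lt2 => /=; rewrite -/m addn1; case: ltnP.
  apply: runs_seq; apply: runs_weaken (runs_check_good I s2) _ _ => //.
  move=> s3 _ g3 [fr3 fm3].
  have i3 : regs s3 r_i = regs s2 r_i by rewrite fr3.
  have found3 : regs s3 r_found = regs s2 r_found by rewrite fr3.
  have {}g3 : (regs s3 r_good != 0) = p (regs s2 r_i).
    by rewrite g3 m2 b2 u2.
  have pS : all p (iota 1 (regs s2 r_i)) =
      all p (iota 1 (regs s2 r_i).-1) && p (regs s2 r_i).
    case: (regs s2 r_i) i2_gt0 => // k _.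
    by rewrite -pred_Sn -[k.+1 in LHS]addn1 iotaD all_cat /= andbT add1n.
  apply: runs_seq; apply: runs_if => /= [good3|bad3].
    apply: runs_skip => // _; apply: runs_assign => _ /=.
    rewrite /upd /= i3 addn1 /= pS -g3 good3 andbT found3; split=> //; lia.
  apply: runs_assign => _; apply: runs_assign => _ /=.
  rewrite /upd /= i3 addn1 /= pS -g3 bad3 andbF; split=> //; lia.
move=> s' _ [[/andP[_ le'] ->]] /= e0.
suff -> : regs s' r_i = m.+1 by [].
by move: e0; rewrite -/m addn1; apply: contra_eq => ne; rewrite ltn_neqAle ne le'.
Qed.

(** The first alternative is the exit condition of Procedure 1, the second one pass of its loop.
    Badness always refers to the set before the pass, as the scan ends with the first removal. *)
Lemma runs_remove_bad I s :
  let n := in_vertices I in let b := regs s r_base in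
  runs I remove_bad s (100 * (in_digraphs I).+1 * n.+1 ^ 2) (fun s' =>
    [/\ regs s' r_found = 0, memory s' = memory s &
        forall u, u < n -> memory s (b + u) != 0 ->
          ~~ bad_number I (memory s) b u] \/
    regs s' r_found != 0 /\
    exists u, [/\ u < n, memory s (b + u) != 0, bad_number I (memory s) b u &
                  memory s' = upd (memory s) (b + u) 0]).
Proof.
move=> n b; set m := in_digraphs I.
pose W := m * (30 * n.+1 + 14) + 6.
(* Only the first alternative depends on the scan position [k]: after a removal the guard stops the
   scan. *)
pose inv k s' :=
  [/\ regs s' r_found = 0, memory s' = memory s &
        forall u, u < k -> memory s (b + u) != 0 ->
          ~~ bad_number I (memory s) b u] \/
    regs s' r_found != 0 /\
    exists u, [/\ u < n, memory s (b + u) != 0, bad_number I (memory s) b u &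
                  memory s' = upd (memory s) (b + u) 0].
(* Per vertex: 8 for the guard, 5 for the membership test, 2 for setting [r_i], [W] for the inner
   loop, 7 for the conditional removal and 4 for the increment. *)
apply: (runs_weaken (T := 2 + (2 + (n * (8 + ((5 + (2 + (W + 7))) + 4)) + 8)))
   (Q := inv n)); last by [].
2: by rewrite /W -mulnn; nia.
apply: runs_seq; apply: runs_assign => _.
apply: runs_seq; apply: runs_assign => _; set s1 := State _ _ => /=.
rewrite -{1}[n](subn0 n) -[X in n - X]/(regs s1 r_u).
apply: (runs_weaken (Q := fun s' => (regs s' r_u <= n /\ inv (regs s' r_u) s') /\
  eval I s' (And (Lt (Reg r_u) NumVertices) (Not (Reg r_found))) = 0) _ (leqnn _)).
  apply: (runs_while (mu := fun s => n - regs s r_u)).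
    by split=> //; left; split.
  move=> s2 [fr fm] [le2 inv2] g2.
  have {g2} [lt2 f2] : regs s2 r_u < n /\ regs s2 r_found = 0.
    by move: g2 => /=; rewrite -/n; case: (regs s2 r_found) => [|k];
       case: ltnP; rewrite ?andbF.
  have b2 : regs s2 r_base = b by rewrite fr.
  case: inv2 => [[_ m2 ok2]|[]]; last by rewrite f2.
  apply: runs_seq; apply: runs_if => /=; rewrite b2 m2 => mem2; last first.
    apply: runs_skip => // _; apply: runs_assign => _ /=.
    rewrite /upd /= addn1; split; last by lia.
    split=> //; left; split=> //= u; rewrite ltnS leq_eqVlt => /orP[/eqP->|/ok2 //].
    by rewrite mem2.
  apply: runs_seq; apply: runs_assign => _; set s3 := State _ _.
  have check3 := @runs_check_vertex I s3 erefl f2.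
  apply: runs_seq; apply: runs_weaken check3 (leqnn _) _.
  move=> s4 _; rewrite /s3 /upd /= b2 m2 => bad4 [fr4 fm4].
  have m4 : memory s4 = memory s by rewrite fm4.
  have u4 : regs s4 r_u = regs s2 r_u by rewrite fr4.
  have b4 : regs s4 r_base = b by rewrite fr4.
  apply: runs_if => /= found4.
    apply: runs_store => _; apply: runs_assign => _ /=.
    rewrite /upd /= u4 addn1; split; last by lia.
    split=> //; right; split=> //=; exists (regs s2 r_u).
    by rewrite m4 b4 -bad4.
  apply: runs_skip => // _; apply: runs_assign => _ /=.
  rewrite /upd /= u4 addn1; split; last by lia.
  split=> //; left; split=> //= u; rewrite ltnS leq_eqVlt => /orP[/eqP->|/ok2 //].
  by rewrite -bad4 found4.
move=> s' _ [[le' [[f0 m' ok]|]]] /= e0; last by right.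
left; split=> //; move: e0; rewrite -/n f0 /= andbT.
by case: ltnP => // ge' _ u un; apply: ok; apply: leq_trans un ge'.
Qed.

Lemma runs_test_nonempty I s :
  runs I test_nonempty s (15 * (in_vertices I).+1) (fun s' =>
    (regs s' r_ans != 0) =
      has (fun u => memory s (regs s r_base + u) != 0)
        (iota 0 (in_vertices I))).
Proof.
set n := in_vertices I; pose p u := memory s (regs s r_base + u) != 0.
apply: (runs_weaken (T := 2 + (2 + (n * (4 + ((5 + 2) + 4)) + 4)))
  (Q := fun s' => (regs s' r_ans != 0) = has p (iota 0 n))) => //; last by lia.
apply: runs_seq; apply: runs_assign => _.
apply: runs_seq; apply: runs_assign => _; set s1 := State _ _ => /=.
rewrite -{1}[n](subn0 n) -[X in n - X]/(regs s1 r_u).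
apply: (runs_weaken (Q := fun s' => ((regs s' r_u <= n) /\
   (regs s' r_ans != 0) = has p (iota 0 (regs s' r_u))) /\
    eval I s' (Lt (Reg r_u) NumVertices) = 0) _ (leqnn _)).
  apply: (runs_while (mu := fun s => n - regs s r_u)) => //.
  move=> s2 [fr fm] [le2 a2] lt2.
  have m2 : memory s2 = memory s by rewrite fm.
  have b2 : regs s2 r_base = regs s r_base by rewrite fr.
  have {}lt2 : regs s2 r_u < n by move: lt2 => /=; rewrite -/n; case: ltnP.
  have hS k : has p (iota 0 k.+1) = has p (iota 0 k) || p k.
    by rewrite -addn1 iotaD has_cat /= orbF.
  apply: runs_seq; apply: runs_if; rewrite /= m2 b2 => pv.
    apply: runs_assign => _; apply: runs_assign => _ /=.
    rewrite /upd /= addn1 hS; split; last by lia.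
    by split=> //; rewrite /p pv orbT.
  apply: runs_skip => // _; apply: runs_assign => _ /=.
  rewrite /upd /= addn1 hS a2; split; last by lia.
  by split=> //; rewrite /p pv orbF.
move=> s' _ [[le' ->]] /= e0.
suff -> : regs s' r_u = n by [].
by apply/eqP; rewrite eqn_leq le' /= leqNgt; case: ltnP e0.
Qed.

(** * Correctness of Procedure 1 on a graph system *)

Section OneGraphSystem.
Variables (V : finType) (G : graph_system V).
Implicit Types (mem : nat -> nat) (b : nat) (S : {set V}).

Definition stored_set mem b : {set V} :=
  [set x : V | mem (b + enum_rank x) != 0].

Definition all_good S : bool := [forall u in S, good G S u].

Lemma enum_rankE u : u < #|V| -> exists x : V, u = enum_rank x.
Proof. by move=> un; exists (enum_val (Ordinal un)); rewrite enum_valK. Qed.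

Lemma system_adjE i (x y : V) : i < num_digraphs G ->
  exists2 k : 'I_(num_digraphs G), k = i :> nat &
    system_adj G i.+1 (enum_rank x) (enum_rank y) = edge k x y.
Proof.
move=> im; exists (Ordinal im) => //; rewrite /system_adj !valK /= insubT.
by rewrite !enum_rankK; congr (edge _ x y); apply: val_inj.
Qed.

Lemma bad_numberE mem b (x : V) :
  bad_number (system_input G) mem b (enum_rank x) =
  ~~ good G (stored_set mem b) x.
Proof.
congr (~~ _).
(* The shift by one: layer [i.+1] of the input is the digraph of index [i], since layer 0 is
   [edge0]. *)
have goodE i (k : 'I_(num_digraphs G)) : k = i :> nat ->
    good_number (system_input G) mem b i.+1 (enum_rank x) =
    good_at k (stored_set mem b) x.
  move=> ki; rewrite /good_number /=; apply/hasP/exists_inP.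
    move=> [v]; rewrite mem_iota => /andP[_ /enum_rankE[y ->]] /andP[my].
    have im : i < num_digraphs G by rewrite -ki.
    have [k' k'i adjE] := system_adjE x y im.
    rewrite -[system_adj _ _ _ _]/(system_adj G i.+1 _ _) adjE => ed.
    exists y; first by rewrite inE.
    by rewrite (_ : k = k') //; apply: ord_inj; rewrite ki k'i.
  move=> [y]; rewrite inE => my ed; exists (enum_rank y : nat).
    by rewrite mem_iota /=.
  rewrite my; have im : i < num_digraphs G by rewrite -ki.
  have [k' k'i adjE] := system_adjE x y im.
  suff: edge k' x y by rewrite -adjE.
  by rewrite (_ : k' = k) //; apply: ord_inj; rewrite ki k'i.
apply/allP/forallP => [h k|h i].
  rewrite -(goodE k) //; apply: h.
  by rewrite mem_iota /= add1n ltnS ltn_ord.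
rewrite mem_iota /= add1n; case: i => // i /andP[_]; rewrite ltnS => im.
by rewrite (goodE i (Ordinal im)).
Qed.

(** Out-neighbours in the smaller set remain available in the larger one. Contraposed, a vertex bad
    in Gamma belongs to no subset of Gamma whose vertices are all good in it, so its removal is
    harmless. *)
Lemma good_sub S S' u : S \subset S' -> good G S u -> good G S' u.
Proof.
move=> SS' /forallP gu; apply/forallP => i.
have /exists_inP[v vS ed] := gu i.
by apply/exists_inP; exists v => //; apply: (subsetP SS').
Qed.

Lemma stored_set_upd mem b (x : V) :
  stored_set (upd mem (b + enum_rank x) 0) b = stored_set mem b :\ x.
Proof.
apply/setP=> y; rewrite !inE /upd eqn_add2l.
by rewrite (inj_eq val_inj) (inj_eq enum_rank_inj); case: (y =P x).
Qed.

Lemma has_stored mem b :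
  has (fun u => mem (b + u) != 0) (iota 0 #|V|) = (stored_set mem b != set0).
Proof.
apply/hasP/set0Pn => [[u]|[x]].
  rewrite mem_iota => /andP[_ /enum_rankE[x ->]] mx.
  by exists x; rewrite inE.
rewrite inE => mx; exists (enum_rank x : nat) => //.
by rewrite mem_iota /=.
Qed.

(** The final Gamma is the largest subset of [Y] whose vertices are all good in it, whatever the
    order of removals. The clause on memory protects the listed sets still to be processed, since
    Gamma overwrites its own block. *)
Lemma runs_procedure1 s :
  let b := regs s r_base in let Y := stored_set (memory s) b in
  runs (system_input G) procedure1 s
    (200 * (num_digraphs G).+1 * #|V|.+1 ^ 3) (fun s' =>
    (forall a, ~~ (b <= a < b + #|V|) -> memory s' a = memory s a) /\
    exists Gamma : {set V},
      [/\ Gamma \subset Y, all_good Gamma,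
          forall Z : {set V}, Z \subset Y -> all_good Z -> Z \subset Gamma &
          (regs s' r_ans != 0) = (Gamma != set0)]).
Proof.
move=> b Y; set n := #|V|; set m := num_digraphs G.
pose Gam s' := stored_set (memory s') b.
pose R := 100 * m.+1 * n.+1 ^ 2.
pose inv s' :=
  [/\ (forall a, ~~ (b <= a < b + n) -> memory s' a = memory s a),
      Gam s' \subset Y, regs s' r_found = 0 -> all_good (Gam s') &
      forall Z : {set V}, Z \subset Y -> all_good Z -> Z \subset Gam s'].
(* A pass that removes a vertex shrinks Gamma; the last pass removes nothing but clears [r_found],
   which the second summand records. Hence at most [n.+1] passes. *)
pose mu s' := #|Gam s'| + (regs s' r_found != 0).
pose s1 := State (upd (regs s) r_found 1) (memory s).
apply: (runs_weaken (T := 2 + ((mu s1 * (2 + R) + 2) + 15 * n.+1)) _ _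
  (fun _ _ => id)); last first.
  have mu1 : mu s1 <= n.+1.
    by rewrite /mu -addn1; apply: leq_add; [apply: max_card|apply: leq_b1].
  have := leq_mul mu1 (leqnn (2 + R)); rewrite /R !expnS expn0.
  by move: (mu s1 * _) => x; nia.
apply: runs_seq; apply: runs_assign => _; rewrite -/s1.
apply: runs_seq; apply: (runs_weaken _ (leqnn _)).
  apply: (runs_while (mu := mu) (P := inv)).
    split=> //; exact: subxx.
  move=> s2 [fr fm] [out2 sub2 good2 max2] /= f2.
  have b2 : regs s2 r_base = b by rewrite fr.
  apply: runs_weaken (runs_remove_bad (system_input G) s2) (leqnn _) _.
  rewrite /= b2 => s3 _ H _; case: H => [[f3 m3 ok]|[f3 [u [un mu2 bad m3]]]].
    have G3 : Gam s3 = Gam s2 by rewrite /Gam m3.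
    rewrite /mu /inv G3 f3 f2 /= addn0 addn1; split=> //; split=> //.
      by move=> a /out2; rewrite m3.
    move=> _; apply/forall_inP => x; rewrite inE => mx.
    by have := ok _ (ltn_ord (enum_rank x)) mx; rewrite bad_numberE negbK.
  have [x ux] := enum_rankE un; subst u.
  have G3 : Gam s3 = Gam s2 :\ x by rewrite /Gam m3 stored_set_upd.
  have x2 : x \in Gam s2 by rewrite inE.
  rewrite /mu /inv G3 f3 f2 (cardsD1 x (Gam s2)) x2; split; last by lia.
  split.
  - move=> a na; rewrite m3 /upd; case: eqP => [ea|_]; last exact: out2.
    by move: na; rewrite ea leq_addr ltn_add2l un.
  - exact: subset_trans (subsetDl _ _) sub2.
  - by move=> f0; rewrite f0 in f3.
  (* If [Z] contained the removed [x], then [x], being good in [Z], would be good in the old Gamma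
     as well. *)
  move=> Z ZY goodZ; have ZG := max2 Z ZY goodZ.
  rewrite subsetD1 ZG /=; apply/negP => xZ.
  move: bad; rewrite bad_numberE => /negP; apply.
  by apply: good_sub ZG _; move/forall_inP: goodZ; apply.
move=> s2 [fr _] [[out2 sub2 good2 max2] /= f2] _.
apply: runs_weaken (runs_test_nonempty (system_input G) s2) (leqnn _) _.
have b2 : regs s2 r_base = b by rewrite fr.
rewrite /= b2 has_stored => s3 [_ fm3] a3; split.
  by move=> a /out2; rewrite fm3.
by exists (Gam s2); split=> //; apply: good2.
Qed.
End OneGraphSystem.

(** * The listed maximal independent sets and their number *)

Section Enumeration.
Variables (V : finType) (G : graph_system V).
Implicit Types (S Y Z : {set V}).

Lemma is_gisE S : is_gis G S = [&& S != set0, independent G S & all_good G S].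
Proof. by []. Qed.

Lemma independent_sub S S' : S \subset S' -> independent G S' -> independent G S.
Proof.
move=> /subsetP SS' /forall_inP ind; apply/forall_inP => u /SS' /ind /forall_inP indu.
by apply/forall_inP => v /SS' /indu.
Qed.

(** Since [G_0] has no self-loops, singletons are independent, so the empty set is not maximal once
    there is a vertex. *)
Lemma maximal_independent_neq0 Y :
  0 < #|V| -> maximal_independent G Y -> Y != set0.
Proof.
move=> /card_gt0P[x _] /maxsetP[_ maxY]; apply/eqP => Y0.
suff /maxY : independent G [set x].
  by rewrite Y0 sub0set => /(_ isT)/setP/(_ x); rewrite !inE eqxx.
apply/forall_inP => u; rewrite inE => /eqP->.
by apply/forall_inP => v; rewrite inE => /eqP->; rewrite edge0_irr.
Qed.

Variable s : state.
Hypothesis listed : lists_maximal_independent_sets G s.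

Lemma listed_set_maximal k :
  k < regs s r_count -> maximal_independent G (listed_set V s k).
Proof.
move=> kc; have : listed_set V s k \in listed_sets V s.
  by apply: map_f; rewrite mem_iota.
by rewrite (perm_mem listed) mem_enum.
Qed.

Lemma maximal_listed Y : maximal_independent G Y ->
  exists2 k, k < regs s r_count & Y = listed_set V s k.
Proof.
move=> Ymax; have : Y \in listed_sets V s by rewrite (perm_mem listed) mem_enum.
by case/mapP => k; rewrite mem_iota => /andP[_ kc] ->; exists k.
Qed.

Lemma count_le_time c t :
  exec (system_input G) c init_state s t -> regs s r_count <= t.
Proof.
(* Without vertices the blocks have length 0, but then at most one set is listed and every run takes
   at least one step. *)
move=> ex; have [V0|n0] := posnP #|V|.
  apply: leq_trans (exec_time_gt0 ex).
  have := perm_size listed; rewrite size_map size_iota -cardE => ->.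
  by apply: leq_trans (max_card _) _; rewrite -cardsT -powersetT card_powerset cardsT V0.
have [l sl hl] := exec_memory_changes ex.
have cell_of (k : 'I_(regs s r_count)) :
    {x : V | memory s (k * #|V| + enum_rank x) != 0}.
  apply: sigW; have := maximal_independent_neq0 n0 (listed_set_maximal (ltn_ord k)).
  by case/set0Pn => x; rewrite inE; exists x.
(* [f] picks a nonzero cell in block [k]. Division by the block length recovers [k], so these
   addresses are distinct, and each differs from its initial value 0. *)
pose f (k : 'I_(regs s r_count)) := k * #|V| + enum_rank (sval (cell_of k)).
have f_inj : injective f.
  move=> j k /(congr1 (divn^~ #|V|)).
  by rewrite !divnMDl // !divn_small // !addn0 => /ord_inj.
have fl : {subset map f (enum 'I_(regs s r_count)) <= l}.
  by move=> a /mapP[k _ ->]; apply: hl; apply: svalP (cell_of k).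
have := uniq_leq_size _ fl; rewrite size_map size_enum_ord => le.
by apply: leq_trans sl; apply: le; rewrite (map_inj_uniq f_inj) enum_uniq.
Qed.

End Enumeration.

(** * Correctness and step count of Algorithm-A *)

Lemma runs_algorithmA (V : finType) (G : graph_system V) enumerate s t :
  exec (system_input G) enumerate init_state s t ->
  lists_maximal_independent_sets G s ->
  runs (system_input G) (algorithmA enumerate) init_state
    (300 * t * (num_digraphs G).+1 * #|V|.+1 ^ 3)
    (fun s' => regs s' r_ans != 0 <-> has_gis G).
Proof.
move=> ex listed; set n := #|V|; set m := num_digraphs G.
have count_t := count_le_time listed ex; have t_gt0 := exec_time_gt0 ex.
set N := regs s r_count in count_t *.
pose P := 200 * m.+1 * n.+1 ^ 3.
(* Each of the [N] passes costs [P] plus overhead; as [N <= t], the enumeration time becomes a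
   factor of the whole bound. *)
apply: (runs_weaken (T := t + (2 + (2 + (2 + (N * (8 + (P + (4 + 4))) + 8)))))
  _ _ (fun _ _ => id)); last first.
  have := leq_mul count_t (leqnn (8 + (P + (4 + 4)))).
  have := leq_pmulr t (_ : 0 < m.+1 * n.+1 ^ 3).
  rewrite muln_gt0 expn_gt0 => /(_ isT).
  by rewrite /P; move: (n.+1 ^ 3) (m.+1) (N * _) => x y z; nia.
apply: runs_seq; exists s, t; split=> // _.
apply: runs_seq; apply: runs_assign => _.
apply: runs_seq; apply: runs_assign => _.
apply: runs_seq; apply: runs_assign => _; set s1 := State _ _.
(* Blocks before [r_k] may have been overwritten, so only later cells are claimed intact, and the
   sets already processed are read from the state [s] right after the enumeration. *)
pose inv s' :=
  [/\ regs s' r_base = regs s' r_k * n, regs s' r_k <= N,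
      (forall a, regs s' r_k * n <= a -> memory s' a = memory s a),
      (regs s' r_ans != 0 -> has_gis G) &
      (regs s' r_ans = 0 -> forall k (Z : {set V}), k < regs s' r_k ->
         is_gis G Z -> ~~ (Z \subset listed_set V s k))].
rewrite -{1}[N](subn0 N) -[X in N - X]/(regs s1 r_k).
apply: (runs_weaken (Q := fun s' => inv s' /\
  eval (system_input G) s' (And (Lt (Reg r_k) (Reg r_count)) (Not (Reg r_ans))) = 0)
  _ (leqnn _)).
  apply: (runs_while (mu := fun s => N - regs s r_k)).
    by split.
  move=> s2 [fr _] [base2 le2 mem2 _ no_gis2] g2.
  have count2 : regs s2 r_count = N by rewrite fr.
  have {g2} [lt2 ans2] : regs s2 r_k < N /\ regs s2 r_ans = 0.
    by move: g2 => /=; rewrite count2; case: (regs s2 r_ans) => [|k];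
       case: ltnP; rewrite ?andbF.
  have {}no_gis2 := no_gis2 ans2.
  have Y2 : stored_set V (memory s2) (regs s2 r_base) =
            listed_set V s (regs s2 r_k).
    by apply/setP => x; rewrite !inE base2 mem2 // leq_addr.
  apply: runs_seq; apply: runs_weaken (runs_procedure1 G s2) (leqnn _) _.
  rewrite Y2 /= => s3 _ [out3 [Gamma [GammaY goodGamma maxGamma ans3]]] [fr3 _].
  have k3 : regs s3 r_k = regs s2 r_k by rewrite fr3.
  have base3 : regs s3 r_base = regs s2 r_base by rewrite fr3.
  apply: runs_seq; apply: runs_assign => _; apply: runs_assign => _.
  rewrite /inv /upd /= k3 base3 base2 addn1; split; last by lia.
  split=> //; first by rewrite mulSn addnC.
  - move=> a ka; rewrite out3 ?mem2 //.
      by apply: leq_trans ka; rewrite mulSn leq_addl.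
    by rewrite base2 negb_and -leqNgt -/n -mulSnr ka orbT.
  (* Soundness: Gamma inherits independence from the listed set containing it. *)
  - rewrite ans3 => Gamma0; exists Gamma; rewrite is_gisE Gamma0 goodGamma andbT.
    apply: independent_sub GammaY _.
    by have /maxsetP[] := listed_set_maximal listed lt2.
  - move=> a0 k Z; rewrite ltnS leq_eqVlt => /orP[/eqP->|]; last exact: no_gis2.
    rewrite is_gisE => /and3P[Z0 _ goodZ]; apply/negP => ZY.
    have := maxGamma _ ZY goodZ; move: ans3; rewrite a0 => /esym/negbFE/eqP ->.
    by rewrite subset0 (negPf Z0).
move=> s' [fr _] [[_ le' _ yes no] e0]; split=> // -[Z gisZ].
have count' : regs s' r_count = N by rewrite fr.
(* Completeness: stopping with answer 0 means that every listed set was processed, yet a GIS extends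
   to a maximal independent set, which is one of them. *)
apply/eqP => ans0.
have kN : regs s' r_k = N.
  move: e0; rewrite /= count' ans0 /= andbT; case: ltnP => // ge' _.
  by apply/eqP; rewrite eqn_leq le'.
have /and3P[_ indZ _] := gisZ.
have [Y Ymax ZY] := maxset_exists indZ.
have [k kc Yk] := maximal_listed listed Ymax.
by have := no ans0 k Z; rewrite kN -Yk ZY => /(_ kc gisZ).
Qed.

(** * Absorbing polynomial factors into a larger exponential *)

Local Open Scope ring_scope.

Lemma bernoulli_ineq (R : realDomainType) (x : R) n :
  0 <= x -> 1 + n%:R * x <= (1 + x) ^+ n.
Proof.
move=> x0; elim: n => [|n IH]; first by rewrite mul0r addr0 expr0.
rewrite exprS; apply: le_trans (ler_wpM2l _ IH); last by rewrite addr_ge0.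
have : 0 <= n%:R * (x * x) by rewrite !mulr_ge0.
by rewrite -natr1; nra.
Qed.

(** Induction on [d] through the midpoint [e] of [b] and [c]: raising the base from [b] to [e]
    absorbs one factor [n.+1], and the induction hypothesis from [e] to [c] absorbs the others. *)
Lemma poly_geometric_bounded (R : realFieldType) (d : nat) (b c : R) :
  0 < b -> b < c ->
  exists2 M : R, 0 <= M & forall n, n.+1%:R ^+ d * b ^+ n <= M * c ^+ n.
Proof.
elim: d b c => [|d IH] b c b0 bc.
  exists 1 => // n; rewrite expr0 !mul1r lerXn2r ?nnegrE ?ltW //.
  exact: lt_trans bc.
pose e := (b + c) / 2.
have be : b < e by rewrite /e; lra.
have ec : e < c by rewrite /e; lra.
have [M M0 hM] := IH e c (lt_trans b0 be) ec.
pose x := e / b - 1.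
have x0 : 0 < x by rewrite /x subr_gt0 ltr_pdivlMr ?mul1r.
have xV0 : 0 <= 1 + x^-1 by rewrite addr_ge0 // invr_ge0 ltW.
have bx : b * (1 + x) = e by rewrite /x; field; rewrite gt_eqF.
exists ((1 + x^-1) * M) => [|n].
  exact: mulr_ge0.
have lin : n.+1%:R * b ^+ n <= (1 + x^-1) * e ^+ n.
  rewrite -bx exprMn [b ^+ n * _]mulrC mulrA ler_pM2r ?exprn_gt0 // [leRHS]mulrC.
  (* The product expands to [n + 1 + n x + 1/x], which is at least [n + 1]; Bernoulli then bounds
     its first factor. *)
  apply: le_trans (_ : (1 + n%:R * x) * (1 + x^-1) <= _).
    rewrite -natr1 mulrDl mul1r mulrDr mulr1 -mulrA divff ?gt_eqF // mulr1.
    have x'0 : 0 <= x^-1 by rewrite invr_ge0 ltW.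
    by have := mulr_ge0 (ler0n R n) (ltW x0); lra.
  by apply: ler_wpM2r => //; apply: bernoulli_ineq; apply: ltW.
rewrite exprSr -mulrA; apply: le_trans (ler_wpM2l _ lin) _.
  by rewrite exprn_ge0.
by rewrite mulrCA -!mulrA ler_wpM2l.
Qed.

Lemma cube_root3X (R : realType) n : (3 `^ (3^-1)) ^+ n = 3 `^ (n%:R / 3) :> R.
Proof. by rewrite -powR_mulrn ?powR_ge0 // -powRrM mulrC. Qed.

(** The constant is the cube root of 3 rounded up: its cube is about 3.0003. This strict gap leaves
    room for the polynomial factor. *)
Lemma cube_root3_lt_delta0 (R : realType) : 3 `^ (3^-1) < delta0 R.
Proof.
rewrite ltNge; apply/negP => h.
have : delta0 R ^+ 3 <= (3 `^ (3^-1)) ^+ 3.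
  by rewrite lerXn2r ?nnegrE ?powR_ge0 // /delta0; lra.
rewrite cube_root3X divff ?pnatr_eq0 // powRr1 //.
by rewrite /delta0; lra.
Qed.

Theorem theorem2p2 (R : realType) (enumerate : cmd)
    (enumerateP : mis_enumerator R enumerate) :
  decides_cis_in_time (algorithmA enumerate) (delta0 R).
Proof.
have [C [d enumP]] := enumerateP.
have root_gt0 : 0 < 3 `^ (3^-1) :> R by rewrite powR_gt0.
(* The exponent is [d] from the enumeration plus 3 from Procedure 1. *)
have [M M0 hM] := poly_geometric_bounded (d + 3) root_gt0 (@cube_root3_lt_delta0 R).
(* 600 is 300 times the 2 from [m + 1 <= 2 m], valid as [m >= 1]. The absolute value guards against
   a negative [C] when products are compared. *)
exists (600 * `|C| * M), 1%N => V G.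
have [s [t [ex listed t_le]]] := enumP V G.
have [s' [t' [ex' t'_le ans]]] := runs_algorithmA ex listed.
exists s', t'; split=> //; rewrite expr1.
have {}t_le : t%:R <= `|C| * (#|V|.+1%:R ^+ d * (3 `^ (3^-1)) ^+ #|V|).
  apply: le_trans t_le _; rewrite -mulrA.
  by rewrite cube_root3X ler_wpM2r ?ler_norm // mulr_ge0 ?exprn_ge0 ?powR_ge0.
have m_le : (num_digraphs G).+1%:R <= 2 * (num_digraphs G)%:R :> R.
  by rewrite -natrM ler_nat; have := num_digraphs_gt0 G; lia.
have := hM #|V|; rewrite exprD => {}hM.
apply: le_trans (_ : (300 * t * (num_digraphs G).+1 * #|V|.+1 ^ 3)%N%:R <= _).
  by rewrite ler_nat.
rewrite 3!natrM natrX.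
set A := #|V|.+1%:R ^+ 3; have A0 : 0 <= A by rewrite exprn_ge0.
apply: le_trans (_ : 300 * (`|C| * (#|V|.+1%:R ^+ d * (3 `^ (3^-1)) ^+ #|V|)) *
    (2 * (num_digraphs G)%:R) * A <= _).
  by rewrite ler_wpM2r // ler_pM // ?mulr_ge0 // ler_wpM2l.
rewrite [leLHS](_ : _ = 600 * `|C| * (num_digraphs G)%:R *
  (#|V|.+1%:R ^+ d * A * (3 `^ (3^-1)) ^+ #|V|)); last by ring.
rewrite [leRHS](_ : _ = 600 * `|C| * (num_digraphs G)%:R *
  (M * delta0 R ^+ #|V|)); last by ring.
by rewrite ler_wpM2l // !mulr_ge0.
Qed.
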